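(* Let $h\in\mathbb{R}^d$ be fixed, let $n\ge1$, and let $h_1,\ldots,h_n\in\mathbb{R}^d$ be fixed nonzero vectors. The following functions $f$ on $\mathbb{P}_d$ are geodesically convex with respect to the affine-invariant Riemannian metric: (1) $f(X)=\log\left(\sum_{i=1}^n h_i^\top X h_i\right)$; (2) $f(X)=\log\det(X)$; (3) $f(X)=h^\top X h$; (4) $f(X)=\operatorname{tr}(X)$; (5) $f(X)=\delta_S^2(X,Y):=\log\det\left(\frac{X+Y}{2}\right)-\frac12\log\det(XY)$ for fixed $Y\in\mathbb{P}_d$; (6) $f(X)=\left\|\log\left(Y^{-1/2}XY^{-1/2}\right)\right\|_F^2$ for fixed $Y\in\mathbb{P}_d$; (7) $f(X)=\sup_{y\in\mathbb{R}^d,\ \|y\|_2=1}y^\top X y$; (8) the matrix-valued function $f(X)=X^{-1}$, where geodesic convexity is with respect to the Löwner order.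
   Context: $\mathbb{P}_d$ is the set of $d\times d$ real symmetric positive definite matrices, equipped with the affine-invariant Riemannian metric $\langle U,V\rangle_X=\operatorname{tr}(X^{-1}UX^{-1}V)$; the unique geodesic from $A$ to $B$ is $A\sharp_t B=A^{1/2}(A^{-1/2}BA^{-1/2})^tA^{1/2}$, $t\in[0,1]$. A real-valued function $f$ on $\mathbb{P}_d$ is geodesically convex if $f(A\sharp_t B)\le(1-t)f(A)+tf(B)$ for all $A,B\in\mathbb{P}_d$, $t\in[0,1]$; for a matrix-valued function with symmetric values the inequality is replaced by $\preceq$, the Löwner order ($A\preceq B$ iff $B-A$ is positive semidefinite). $\log$ of a positive definite matrix is the matrix logarithm, and $\|\cdot\|_F$ is the Frobenius norm. *)

(* Defs.v *)
From mathcomp Require Import all_boot all_order all_algebra.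
From mathcomp Require Import all_classical all_reals all_analysis.

Set Implicit Arguments.
Unset Strict Implicit.
Unset Printing Implicit Defensive.

Import Order.TTheory GRing.Theory Num.Theory.
Local Open Scope classical_set_scope.
Local Open Scope ring_scope.

Definition qform {R : realType} {d : nat} (A : 'M[R]_d) (x : 'cV[R]_d) : R :=
  (x^T *m A *m x) ord0 ord0.

Definition posdefmx {R : realType} {d : nat} (A : 'M[R]_d) : Prop :=
  A \is symmetricmx /\ forall x : 'cV[R]_d, x != 0 -> 0 < qform A x.

Definition possemidefmx {R : realType} {d : nat} (A : 'M[R]_d) : Prop :=
  A \is symmetricmx /\ forall x : 'cV[R]_d, 0 <= qform A x.

Definition loewner_le {R : realType} {d : nat} (A B : 'M[R]_d) : Prop :=
  possemidefmx (B - A).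

(* The norm `|M| of the library is the maximum norm of the entries; this is the
   Frobenius norm, which for a column vector is the Euclidean norm. *)
Definition frobenius_norm {R : realType} {m n : nat} (M : 'M[R]_(m, n)) : R :=
  Num.sqrt (\sum_i \sum_j M i j ^+ 2).

(* Functional calculus on real symmetric matrices: f acts on the eigenvalues.
   A symmetric A has a decomposition A = Q diag(v) Q^T with Q orthogonal, and
   by mxfunE below the value does not depend on which one is chosen.  The
   default value 0 is taken only when A is not symmetric. *)
Definition mxfun {R : realType} {d : nat} (f : R -> R) (A : 'M[R]_d) : 'M[R]_d :=
  xget 0 [set B | exists (Q : 'M[R]_d) (v : 'rV[R]_d),
    [/\ Q *m Q^T = 1%:M,
        A = Q *m diag_mx v *m Q^T
      & B = Q *m diag_mx (map_mx f v) *m Q^T]].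

Lemma mxfunE (R : realType) (d : nat) (f : R -> R) (Q : 'M[R]_d)
    (v : 'rV[R]_d) :
  Q *m Q^T = 1%:M ->
  mxfun f (Q *m diag_mx v *m Q^T) = Q *m diag_mx (map_mx f v) *m Q^T.
Proof.
move=> QQ; rewrite /mxfun; case: xgetP => [B _ [P [w [PP eA ->]]]|]; last first.
  by move=> /(_ (Q *m diag_mx (map_mx f v) *m Q^T)); case; exists Q, v.
have PtP := mulmx1C PP; have QtQ := mulmx1C QQ.
pose U := P^T *m Q.
have UE : U *m diag_mx v = diag_mx w *m U.
  have := congr1 (fun M : 'M[R]_d => P^T *m M *m Q) eA.
  by rewrite /= -!mulmxA QtQ mulmx1 !mulmxA PtP mul1mx.
have UfE : U *m diag_mx (map_mx f v) = diag_mx (map_mx f w) *m U.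
  apply/matrixP=> i j; have := congr1 (fun M : 'M[R]_d => M i j) UE.
  rewrite !mul_mx_diag !mul_diag_mx !mxE.
  set u := \sum_k _.
  have [->|u0] := eqVneq u 0; first by rewrite !mulr0 !mul0r.
  by rewrite mulrC => /(mulIf u0) ->; rewrite mulrC.
have := congr1 (fun M : 'M[R]_d => P *m M *m Q^T) UfE.
by rewrite /U !mulmxA PP mul1mx => ->; rewrite -!mulmxA QQ mulmx1.
Qed.

Definition mxpow {R : realType} {d : nat} (A : 'M[R]_d) (t : R) : 'M[R]_d :=
  mxfun (fun x => x `^ t) A.

Definition mxlog {R : realType} {d : nat} (A : 'M[R]_d) : 'M[R]_d :=
  mxfun (@ln R) A.

Definition geodesic {R : realType} {d : nat} (A B : 'M[R]_d) (t : R) : 'M[R]_d :=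
  mxpow A 2^-1 *m
    mxpow (mxpow A (- 2^-1) *m B *m mxpow A (- 2^-1)) t *m mxpow A 2^-1.

Definition geodesically_convex {R : realType} {d : nat} (f : 'M[R]_d -> R) : Prop :=
  forall A B : 'M[R]_d, posdefmx A -> posdefmx B ->
  forall t : R, 0 <= t <= 1 ->
  f (geodesic A B t) <= (1 - t) * f A + t * f B.

Definition loewner_geodesically_convex {R : realType} {d : nat}
    (f : 'M[R]_d -> 'M[R]_d) : Prop :=
  (forall A : 'M[R]_d, posdefmx A -> f A \is symmetricmx) /\
  forall A B : 'M[R]_d, posdefmx A -> posdefmx B ->
  forall t : R, 0 <= t <= 1 ->
  loewner_le (f (geodesic A B t)) ((1 - t) *: f A + t *: f B).

Definition S_divergence {R : realType} {d : nat} (X Y : 'M[R]_d) : R :=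
  ln (\det (2^-1 *: (X + Y))) - 2^-1 * ln (\det (X *m Y)).

(* Main.v *)
Require Import Defs.
From mathcomp Require Import all_boot all_order all_algebra.
From mathcomp Require Import all_classical all_reals all_analysis.
From mathcomp Require Import complex ring lra.

Set Implicit Arguments.
Unset Strict Implicit.
Unset Printing Implicit Defensive.

Import Order.TTheory GRing.Theory Num.Theory.
Local Open Scope classical_set_scope.
Local Open Scope ring_scope.
Import numFieldNormedType.Exports.

(** Two positive definite matrices are simultaneously diagonal up to congruence:
    A = N N^T and B = N diag(w) N^T with N invertible and w > 0, and then
    A #_t B = N diag(w^t) N^T.  The weighted AM-GM inequality
    w^t <= (1 - t) + t w gives (3), (4), (7), and (8) after inversion; Hoelder's
    inequality gives (1); log det is affine along the geodesic.

    For (5), t |-> det (N diag(w^t) N^T + Y) is log-convex.  After a congruence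
    N = 1, and det (diag(w^t) + Z) is log-convex by induction on the size: it is
    affine in the first diagonal entry, with coefficients given by the lower
    right block of Z and by its Schur complement, which are positive definite.

    For (6) one may take Y = 1, by congruence.  By (5), if u_i are the logarithms
    of the eigenvalues of X, then log det (X + e^r) = sum_i log (e^(u_i) + e^r)
    is convex along the geodesic for every r.  Integrating over r in [-L, L],
    log (e^u + e^r) yields u^2 / 2 + u L + C_L + o(1) as L tends to infinity, and
    the terms in u L add up to a multiple of log det X, which is affine.  Hence
    sum_i u_i^2, the square of the norm of log X, is convex. *)

(** * Spectral theorem for real symmetric matrices *)

Lemma symmetricmxP (F : fieldType) (d : nat) (A : 'M[F]_d) :
  reflect (A^T = A) (A \is symmetricmx).
Proof.
rewrite is_hermitianmxE expr0 scale1r map_mx_id // eq_sym.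
exact: eqP.
Qed.

(** Over [R[i]] the matrix is Hermitian, hence unitarily diagonalizable with real spectrum. A real
    root of the characteristic polynomial of the complexified matrix is already a root over [R],
    since field morphisms preserve characteristic polynomials. *)
Lemma symmetric_eigenvalue (R : realType) (d : nat) (A : 'M[R]_d.+1) :
  A^T = A -> exists l, eigenvalue A l.
Proof.
move=> AT; pose f : {rmorphism R -> R[i]} := real_complex R.
pose B := map_mx f A.
have B_herm : B \is hermsymmx.
  apply: realsym_hermsym; first by apply/symmetricmxP; rewrite map_trmx AT.
  by apply/mxOverP => i j; rewrite mxE /= complex_real.
have /mxOverP/(_ 0 0) := hermitian_spectral_diag_real B_herm.
have /hermitian_normalmx/orthomx_spectralP := B_herm.
set P := spectralmx B; set D := spectral_diag B => BE /complex_realP[l lE].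
have PU : P \in unitmx by exact: spectral_unit.
exists l; rewrite eigenvalue_root_char -(fmorph_root f) map_char_poly.
rewrite -eigenvalue_root_char; apply/eigenvalueP; exists (row 0 P).
  rewrite -/B BE !mulmxA -!row_mul mulmxV // mul1mx mul_diag_mx.
  by apply/rowP => j; rewrite !mxE lE.
apply/negP => /eqP row0.
have : row 0 P *m invmx P = row 0 1%:M by rewrite -row_mul mulmxV.
rewrite row0 mul0mx => /matrixP/(_ 0 0)/eqP; rewrite !mxE eqxx eq_sym.
by rewrite oner_eq0.
Qed.

Lemma sqmx_ge0 (R : realDomainType) (d : nat) (v : 'rV[R]_d) : 0 <= (v *m v^T) 0 0.
Proof. by rewrite mxE sumr_ge0 // => i _; rewrite mxE -expr2 sqr_ge0. Qed.

Lemma sqmx_eq0 (R : realDomainType) (d : nat) (v : 'rV[R]_d) :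
  ((v *m v^T) 0 0 == 0) = (v == 0).
Proof.
apply/idP/eqP => [|->]; last by rewrite mul0mx mxE.
rewrite mxE psumr_eq0 => [/allP v0|i _]; last by rewrite mxE -expr2 sqr_ge0.
apply/rowP => i; have := v0 i (mem_index_enum i).
by rewrite mxE -expr2 sqrf_eq0 mxE => /eqP.
Qed.

(* The witness is the Householder reflection along [u - e_0]. *)
Lemma exists_orthogonal_row (R : rcfType) (d : nat) (u : 'rV[R]_d.+1) :
  (u *m u^T) 0 0 = 1 ->
  exists2 H : 'M[R]_d.+1, H *m H^T = 1%:M & row 0 H = u.
Proof.
move=> u1; have [-> | une] := eqVneq u (row 0 1%:M).
  by exists 1%:M; rewrite ?trmx1 ?mul1mx.
pose w := u - row 0 1%:M; pose k := (w *m w^T) 0 0.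
have k0 : k != 0 by rewrite sqmx_eq0 subr_eq0.
have kE : k = 2 - 2 * u 0 0.
  have e1 : (row 0 (1%:M : 'M[R]_d.+1) *m (row 0 1%:M)^T) 0 0 = 1.
    by rewrite -row_mul mul1mx !mxE eqxx.
  have e2 : (row 0 1%:M *m u^T) 0 0 = u 0 0.
    by rewrite -row_mul mul1mx !mxE.
  have e3 : (u *m (row 0 1%:M)^T) 0 0 = u 0 0.
    by rewrite -[_ *m _]trmxK trmx_mul trmxK mxE e2.
  rewrite /k /w linearB /= mulmxBl !mulmxBr.
  have mxB (X Y : 'M[R]_1) : (X - Y) 0 0 = X 0 0 - Y 0 0 by rewrite !mxE.
  by rewrite !mxB u1 e1 e2 e3; ring.
have wwE : w *m w^T = k%:M by rewrite [LHS]mx11_scalar.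
have wE : w = u - row 0 1%:M by [].
clearbody w k; pose c := 2 / k.
exists (1%:M - c *: (w^T *m w)).
  have -> : (1%:M - c *: (w^T *m w))^T = 1%:M - c *: (w^T *m w).
    by rewrite linearB linearZ /= trmx1 trmx_mul trmxK.
  rewrite mulmxBl mul1mx mulmxBr mulmx1.
  rewrite -scalemxAl -scalemxAr mulmxA -(mulmxA w^T) wwE mul_mx_scalar.
  rewrite -scalemxAl !scalerA opprB -[RHS]addr0 -addrA; congr (_ + _).
  rewrite addrC -scalerBl -scalerBl [X in X *: _](_ : _ = 0) ?scale0r //.
  by rewrite /c; field.
(* The first row of the reflection is [e_0 - c (u_0 - 1) w]. As [k = 2 - 2 u_0], the factor
   [c (u_0 - 1)] is -1, which leaves [e_0 + w = u]. *)
rewrite linearB linearZ /= row_mul.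
have -> : row 0 w^T = (u 0 0 - 1)%:M.
  by apply/rowP => i; rewrite ord1 wE !mxE eqxx.
rewrite mul_scalar_mx scalerA [X in X *: _](_ : _ = -1).
  by rewrite scaleN1r opprK wE addrC subrK.
by rewrite /c kE; field; rewrite -kE.
Qed.

(** Induction on the size. An orthogonal [H] whose first row is a unit eigenvector turns the first
    row of [H A H^T] into [l e_0]. By symmetry this matrix is block diagonal, and the induction
    hypothesis diagonalizes the lower right block. *)
Lemma symmetric_spectral (R : realType) (d : nat) (A : 'M[R]_d) :
  A^T = A ->
  exists (Q : 'M[R]_d) (v : 'rV[R]_d),
    Q *m Q^T = 1%:M /\ A = Q *m diag_mx v *m Q^T.
Proof.
elim: d A => [|d IH] A AT.
  by exists 1%:M, 0; rewrite trmx1 mulmx1; split=> //; apply/matrixP => -[].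
have [l /eigenvalueP[v vA v0]] := symmetric_eigenvalue AT.
pose s := (v *m v^T) 0 0.
have s0 : 0 < s by rewrite lt_def sqmx_eq0 v0 sqmx_ge0.
pose u := (Num.sqrt s)^-1 *: v.
have uA : u *m A = l *: u by rewrite -scalemxAl vA !scalerA mulrC.
have [|H HHT H0] := @exists_orthogonal_row _ d u.
  rewrite linearZ /= -scalemxAl -scalemxAr scalerA mxE -/s -expr2 exprVn.
  by rewrite sqr_sqrtr ?ltW // mulVf // gt_eqF.
have HTH := mulmx1C HHT.
pose B : 'M[R]_(1 + d) := H *m A *m H^T.
have BT : B^T = B by rewrite /B !trmx_mul trmxK AT mulmxA.
have B0 : row 0 B = l *: row 0 1%:M.
  by rewrite /B !row_mul H0 uA -scalemxAl -H0 -row_mul HHT.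
have HBH : H^T *m B *m H = A.
  by rewrite /B !mulmxA HTH mul1mx -mulmxA HTH mulmx1.
clearbody B.
have urB : ursubmx B = 0.
  apply/matrixP => i j; rewrite ord1 !mxE.
  have := congr1 (fun M : 'rV_(1 + d) => M 0 (rshift 1 j)) B0.
  rewrite !mxE /= mulr0 => <-; congr (B _ _); exact/val_inj.
have ulB : ulsubmx B = l%:M.
  apply/matrixP => i j; rewrite !ord1 !mxE.
  have := congr1 (fun M : 'rV_(1 + d) => M 0 (lshift d 0)) B0.
  rewrite !mxE /= mulr1 => <-; congr (B _ _); exact/val_inj.
have dlB : dlsubmx B = 0 by rewrite -[dlsubmx B]trmxK trmx_dlsub BT urB trmx0.
have [|Q [w [QQT BE]]] := IH (drsubmx B); first by rewrite trmx_drsub BT.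
pose P : 'M[R]_(1 + d) := block_mx 1%:M 0 0 Q.
pose x : 'rV[R]_(1 + d) := row_mx l%:M w.
exists (H^T *m P), x; split.
  have PPT : P *m P^T = 1%:M.
    rewrite tr_block_mx mulmx_block !trmx0 trmx1 !mulmx0 !mul0mx !addr0 !add0r.
    by rewrite mulmx1 QQT -scalar_mx_block.
  by rewrite trmx_mul trmxK mulmxA -[X in X *m H = _]mulmxA PPT mulmx1.
have BE' : B = P *m diag_mx x *m P^T.
  rewrite diag_mx_row tr_block_mx !mulmx_block !trmx0 trmx1 !mulmx0 !mul0mx.
  rewrite !addr0 !add0r mulmx1 mul1mx -BE -[LHS]submxK urB dlB ulB.
  have -> : diag_mx l%:M = l%:M :> 'M[R]_1.
    by apply/matrixP => i j; rewrite !ord1 !mxE.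
  by rewrite !mul0mx.
by rewrite -HBH BE' trmx_mul trmxK !mulmxA.
Qed.

(** * Positive definite matrices and geodesics *)

Lemma posdefmx_sym (R : realType) (d : nat) (A : 'M[R]_d) : posdefmx A -> A^T = A.
Proof. by case=> /symmetricmxP. Qed.

Lemma qform_congr (R : realType) (m d : nat) (A : 'M[R]_d) (N : 'M[R]_(m, d)) x :
  qform (N *m A *m N^T) x = qform A (N^T *m x).
Proof. by rewrite /qform trmx_mul trmxK !mulmxA. Qed.

Lemma qform_diag (R : realType) (d : nat) (v : 'rV[R]_d) x :
  qform (diag_mx v) x = \sum_i x i ord0 ^+ 2 * v ord0 i.
Proof.
rewrite /qform -mulmxA mxE; apply: eq_bigr => i _.
by rewrite mul_diag_mx !mxE mulrCA mulrC expr2.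
Qed.

Lemma posdefmx_diag (R : realType) (d : nat) (v : 'rV[R]_d) :
  (forall i, 0 < v ord0 i) -> posdefmx (diag_mx v).
Proof.
move=> v_gt0; split=> [|x /matrix0Pn[i [j]]].
  by apply/symmetricmxP; rewrite tr_diag_mx.
rewrite ord1 => xi0; rewrite qform_diag (bigD1 i) //= ltr_pwDl //.
  by rewrite mulr_gt0 // exprn_even_gt0.
by apply: sumr_ge0 => k _; rewrite mulr_ge0 ?sqr_ge0 // ltW.
Qed.

Lemma posdefmx_congr (R : realType) (d : nat) (A N : 'M[R]_d) :
  N \in unitmx -> posdefmx A -> posdefmx (N *m A *m N^T).
Proof.
move=> N_unit [/symmetricmxP AT A_gt0]; split=> [|x x0].
  by apply/symmetricmxP; rewrite !trmx_mul trmxK AT mulmxA.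
rewrite qform_congr A_gt0 //; apply: contra_neq x0 => NTx.
have uNT : N^T \in unitmx by rewrite unitmx_tr.
by rewrite -[x](mulKmx uNT) NTx mulmx0.
Qed.

Lemma posdefmxD (R : realType) (d : nat) (A B : 'M[R]_d) :
  posdefmx A -> posdefmx B -> posdefmx (A + B).
Proof.
move=> [/symmetricmxP AT A_gt0] [/symmetricmxP BT B_gt0]; split=> [|x x0].
  by apply/symmetricmxP; rewrite linearD /= AT BT.
by rewrite /qform mulmxDr mulmxDl mxE addr_gt0 ?A_gt0 ?B_gt0.
Qed.

Lemma posdefmxZ (R : realType) (d : nat) (c : R) (A : 'M[R]_d) :
  0 < c -> posdefmx A -> posdefmx (c *: A).
Proof.
move=> c_gt0 [/symmetricmxP AT A_gt0]; split=> [|x x0].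
  by apply/symmetricmxP; rewrite linearZ /= AT.
by rewrite /qform -scalemxAr -scalemxAl mxE mulr_gt0 ?A_gt0.
Qed.

Lemma posdefmx1 (R : realType) (d : nat) : posdefmx (1%:M : 'M[R]_d).
Proof. by rewrite -diag_const_mx; apply: posdefmx_diag => i; rewrite mxE. Qed.

Lemma posdefmx_gram (R : realType) (d : nat) (N : 'M[R]_d) :
  N \in unitmx -> posdefmx (N *m N^T).
Proof. by move=> uN; rewrite -[N in N *m _]mulmx1; exact: posdefmx_congr (posdefmx1 _ _). Qed.

Lemma orthogonal_unitmx (R : comUnitRingType) (d : nat) (Q : 'M[R]_d) :
  Q *m Q^T = 1%:M -> Q \in unitmx.
Proof. by move/mulmx1_unit => -[]. Qed.

Lemma posdefmx_spectral (R : realType) (d : nat) (A : 'M[R]_d) :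
  posdefmx A ->
  exists (Q : 'M[R]_d) (v : 'rV[R]_d),
    [/\ Q *m Q^T = 1%:M, forall i, 0 < v ord0 i & A = Q *m diag_mx v *m Q^T].
Proof.
move=> pA; have [Q [v [QQT AE]]] := symmetric_spectral (posdefmx_sym pA).
exists Q, v; split=> // i; have uQ := orthogonal_unitmx QQT.
have QTQ := mulmx1C QQT.
(* On the [i]-th column of [Q], a unit eigenvector, the form takes the value [v i]. *)
have := pA.2 (Q *m delta_mx i 0).
rewrite AE qform_congr mulmxA QTQ mul1mx qform_diag (bigD1 i) //=.
rewrite big1 => [|k kNi]; last by rewrite mxE (negPf kNi) /= expr0n mul0r.
rewrite mxE !eqxx expr1n mul1r addr0; apply.
apply: contra_neq (oner_neq0 R) => Qd.
have := congr1 (mulmx Q^T) Qd; rewrite mulmxA QTQ mul1mx mulmx0.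
by move/matrixP/(_ i 0); rewrite !mxE !eqxx.
Qed.

Lemma det_conj_orthogonal (R : comUnitRingType) (d : nat) (Q A : 'M[R]_d) :
  Q *m Q^T = 1%:M -> \det (Q *m A *m Q^T) = \det A.
Proof.
move=> QQT; rewrite !det_mulmx mulrC mulrA -det_mulmx.
by rewrite (mulmx1C QQT) det1 mul1r.
Qed.

Lemma posdefmx_det_gt0 (R : realType) (d : nat) (A : 'M[R]_d) :
  posdefmx A -> 0 < \det A.
Proof.
move=> /posdefmx_spectral[Q [v [QQT v_gt0 ->]]].
by rewrite det_conj_orthogonal // det_diag prodr_gt0.
Qed.

Lemma posdefmx_unit (R : realType) (d : nat) (A : 'M[R]_d) :
  posdefmx A -> A \in unitmx.
Proof. by move/posdefmx_det_gt0 => dA; rewrite unitmxE unitfE gt_eqF. Qed.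

Lemma posdefmx_mxpow (R : realType) (d : nat) (A : 'M[R]_d) (t : R) :
  posdefmx A -> posdefmx (mxpow A t).
Proof.
move=> /posdefmx_spectral[Q [v [QQT v_gt0 ->]]]; rewrite /mxpow mxfunE //.
apply: posdefmx_congr; first exact: orthogonal_unitmx QQT.
by apply: posdefmx_diag => i; rewrite mxE powR_gt0.
Qed.

Lemma mxpowD (R : realType) (d : nat) (A : 'M[R]_d) (s t : R) :
  posdefmx A -> mxpow A s *m mxpow A t = mxpow A (s + t).
Proof.
move=> /posdefmx_spectral[Q [v [QQT v_gt0 ->]]]; rewrite /mxpow !mxfunE //.
rewrite !mulmxA -[X in X *m _ *m _]mulmxA (mulmx1C QQT) mulmx1.
rewrite -[X in X *m _]mulmxA mulmx_diag; congr (_ *m diag_mx _ *m _).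
by apply/rowP => i; rewrite !mxE powRD //; apply/implyP => _; rewrite gt_eqF.
Qed.

Lemma mxpow0 (R : realType) (d : nat) (A : 'M[R]_d) :
  posdefmx A -> mxpow A 0 = 1%:M.
Proof.
move=> /posdefmx_spectral[Q [v [QQT v_gt0 ->]]]; rewrite /mxpow mxfunE //.
rewrite (_ : map_mx _ v = const_mx 1) ?diag_const_mx ?mulmx1 //.
by apply/rowP => i; rewrite !mxE powRr0.
Qed.

Lemma mxpow1 (R : realType) (d : nat) (A : 'M[R]_d) :
  posdefmx A -> mxpow A 1 = A.
Proof.
move=> /posdefmx_spectral[Q [v [QQT v_gt0 ->]]]; rewrite /mxpow mxfunE //.
by congr (_ *m diag_mx _ *m _); apply/rowP => i; rewrite !mxE powRr1 // ltW.
Qed.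

Definition rowpow (R : realType) (d : nat) (w : 'rV[R]_d) (t : R) : 'rV[R]_d :=
  map_mx (fun x => x `^ t) w.

(** Take [N = A^(1/2) Q], where [Q] diagonalizes [A^(-1/2) B A^(-1/2)] with spectrum [w]. The power
    [t] in the geodesic then acts on [w] alone. *)
Lemma geodesic_diagonal (R : realType) (d : nat) (A B : 'M[R]_d) :
  posdefmx A -> posdefmx B ->
  exists (N : 'M[R]_d) (w : 'rV[R]_d),
    [/\ N \in unitmx, forall i, 0 < w ord0 i, A = N *m N^T,
        B = N *m diag_mx w *m N^T &
        forall t, geodesic A B t = N *m diag_mx (rowpow w t) *m N^T].
Proof.
move=> pA pB; pose S := mxpow A 2^-1; pose T := mxpow A (- 2^-1).
have pS : posdefmx S by exact: posdefmx_mxpow.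
have pT : posdefmx T by exact: posdefmx_mxpow.
have [ST TT] := (posdefmx_sym pS, posdefmx_sym pT).
have SS : S *m S = A by rewrite mxpowD // -div1r -splitr mxpow1.
have S_T : S *m T = 1%:M by rewrite mxpowD // subrr mxpow0.
have T_S := mulmx1C S_T.
have pC : posdefmx (T *m B *m T).
  by rewrite -{2}TT; apply: posdefmx_congr => //; exact: posdefmx_unit.
have [Q [w [QQT w_gt0 CE]]] := posdefmx_spectral pC.
have NT : (S *m Q)^T = Q^T *m S by rewrite trmx_mul ST.
exists (S *m Q), w; rewrite NT; split=> //.
- by rewrite unitmx_mul (posdefmx_unit pS) (orthogonal_unitmx QQT).
- by rewrite mulmxA -[X in X *m S]mulmxA QQT mulmx1.
- have := congr1 (fun M => S *m M *m S) CE; rewrite /= !mulmxA S_T mul1mx.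
  by rewrite -mulmxA T_S mulmx1.
- by move=> t; rewrite /geodesic -/S -/T CE /mxpow mxfunE // !mulmxA.
Qed.

(** * Log-convexity of determinants *)

Lemma powR_amgm (R : realType) (x y t : R) :
  0 <= x -> 0 <= y -> 0 <= t <= 1 ->
  x `^ (1 - t) * y `^ t <= (1 - t) * x + t * y.
Proof.
move=> x0 y0 /andP[]; rewrite le_eqVlt => /predU1P[<- _|t0].
  by rewrite subr0 powRr1 // powRr0 !mul1r mul0r addr0 mulr1.
rewrite le_eqVlt => /predU1P[->|t1].
  by rewrite subrr powRr1 // powRr0 !mul1r mul0r add0r.
have s0 : 0 < 1 - t by rewrite subr_gt0.
(* Young's inequality with the conjugate exponents [1 / (1 - t)] and [1 / t], finite now that the
   endpoints are excluded. *)
have := @conjugate_powR R (x `^ (1 - t)) (y `^ t) (1 - t)^-1 t^-1.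
rewrite !powR_ge0 !invr_gt0 !invrK subrK -!powRrM !divff ?gt_eqF // !powRr1 //.
by rewrite [x * _]mulrC [y * _]mulrC; apply.
Qed.

(** Once both sums are normalized to 1, [powR_amgm] applies term by term. *)
Lemma powR_hoelder_sum (R : realType) (I : finType) (x y : I -> R) (t : R) :
  (forall i, 0 <= x i) -> (forall i, 0 <= y i) -> 0 <= t <= 1 ->
  \sum_i x i `^ (1 - t) * y i `^ t <= (\sum_i x i) `^ (1 - t) * (\sum_i y i) `^ t.
Proof.
move=> x0 y0 t01; have /andP[t0 t1] := t01.
have sx0 : 0 <= \sum_i x i by exact: sumr_ge0.
have sy0 : 0 <= \sum_i y i by exact: sumr_ge0.
(* The endpoints come first: zero to the power zero is 1, so the cases of a vanishing sum below rely
   on nonzero exponents. *)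
have [->|tN0] := eqVneq t 0.
  rewrite subr0 powRr0 mulr1 powRr1 // ler_sum // => i _.
  by rewrite powRr0 mulr1 powRr1.
have [->|tN1] := eqVneq t 1.
  rewrite subrr powRr0 mul1r powRr1 // ler_sum // => i _.
  by rewrite powRr0 mul1r powRr1.
have [sxE|sxN0] := eqVneq (\sum_i x i) 0.
  rewrite sxE powR0 ?subr_eq0 1?eq_sym // mul0r big1 // => i _.
  by rewrite (psumr_eq0P (fun i _ => x0 i) sxE) // powR0 ?mul0r // subr_eq0 eq_sym.
have [syE|syN0] := eqVneq (\sum_i y i) 0.
  rewrite syE powR0 // mulr0 big1 // => i _.
  by rewrite (psumr_eq0P (fun i _ => y0 i) syE) // powR0 // mulr0.
set X := \sum_i x i in sx0 sxN0 *; set Y := \sum_i y i in sy0 syN0 *.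
have X0 : 0 < X by rewrite lt_def sxN0.
have Y0 : 0 < Y by rewrite lt_def syN0.
have XY0 : 0 < X `^ (1 - t) * Y `^ t by rewrite mulr_gt0 ?powR_gt0.
rewrite -[leRHS]mul1r -ler_pdivrMr // mulr_suml.
apply: (@le_trans _ _ (\sum_i ((1 - t) * (x i / X) + t * (y i / Y)))).
  apply: ler_sum => i _.
  apply: le_trans (powR_amgm _ _ t01); rewrite ?divr_ge0 //.
  have -> : x i `^ (1 - t) = (x i / X) `^ (1 - t) * X `^ (1 - t).
    by rewrite -powRM ?divfK ?divr_ge0.
  have -> : y i `^ t = (y i / Y) `^ t * Y `^ t.
    by rewrite -powRM ?divfK ?divr_ge0.
  by rewrite mulrACA mulfK ?gt_eqF.
by rewrite big_split /= -!mulr_sumr -!mulr_suml !divff // !mulr1 subrK.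
Qed.

(** Linearity in the first row, split as [q (1, 0) + (p, b)]. The first part yields [q \det E]; in
    the second, eliminating [c] with the pivot [p] leaves the Schur complement. *)
Lemma det_block_pivot (F : fieldType) (d : nat) (p q : F) (b : 'rV[F]_d)
    (c : 'cV[F]_d) (E : 'M[F]_d) :
  p != 0 ->
  \det (block_mx (q + p)%:M b c E) =
    q * \det E + p * \det (E - p^-1 *: (c *m b)).
Proof.
move=> p0; have -> : p * \det (E - p^-1 *: (c *m b)) = \det (block_mx p%:M b c E).
  have <- : block_mx 1%:M 0 (p^-1 *: c) 1%:M *m block_mx p%:M b 0 (E - p^-1 *: (c *m b))
      = block_mx p%:M b c E.
    rewrite mulmx_block !mul1mx !mul0mx !addr0 mul_mx_scalar scalerA.
    by rewrite divff // scale1r -scalemxAl addrC subrK.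
  by rewrite det_mulmx det_lblock det_ublock !det1 !mul1r det_scalar1.
have -> : q * \det E = q * \det (block_mx 1%:M 0 c E).
  by rewrite det_lblock det1 mul1r.
rewrite -[\det (block_mx p%:M b c E)]mul1r.
have lift_row' a a' (b1 b2 : 'rV[F]_d) :
    row' (lshift d (0 : 'I_1)) (block_mx a b1 c E) =
    row' (lshift d (0 : 'I_1)) (block_mx a' b2 c E).
  apply/matrixP => i j; rewrite [LHS]mxE [RHS]mxE.
  have -> : lift (lshift d (0 : 'I_1)) i = rshift 1 i by exact: val_inj.
  by rewrite !col_mxEd.
apply: (determinant_multilinear (i0 := lshift d (0 : 'I_1))).
- apply/rowP => j; rewrite !mxE.
  rewrite -[lshift d 0]/(unsplit (inl 0)) unsplitK !mxE.
  by case: (fintype.split j) => k; rewrite !mxE ?ord1 ?mulr1 ?mul1r ?mulr0 ?add0r.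
- exact: lift_row'.
- exact: lift_row'.
Qed.

Lemma qform_col_mx (R : realType) (m d : nat) (Z : 'M[R]_(m + d)) y x :
  Z^T = Z ->
  qform Z (col_mx y x) =
    qform (ulsubmx Z) y + 2 * (y^T *m ursubmx Z *m x) ord0 ord0 + qform (drsubmx Z) x.
Proof.
move=> ZT; rewrite /qform -{1}[Z]submxK tr_col_mx mul_row_block mul_row_col.
have mxD (A B : 'M[R]_1) : (A + B) ord0 ord0 = A ord0 ord0 + B ord0 ord0.
  by rewrite mxE.
rewrite !mulmxDl !mxD.
have -> : (x^T *m dlsubmx Z *m y) ord0 ord0 = (y^T *m ursubmx Z *m x) ord0 ord0.
  rewrite -[in RHS](trmxK (_ *m x)) [RHS]mxE !trmx_mul trmxK trmx_ursub ZT.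
  by rewrite mulmxA.
by ring.
Qed.

(** The form of [Z] is evaluated at [(1, 0)], at [(0, x)], and at [(y, x)] with [y = - a^-1 b x].
    The last choice minimizes over [y], and the minimum is the form of the Schur complement at
    [x]. *)
Lemma posdefmx_schur (R : realType) (d : nat) (Z : 'M[R]_(1 + d)) :
  posdefmx Z ->
  [/\ 0 < ulsubmx Z 0 0, posdefmx (drsubmx Z) &
      posdefmx (drsubmx Z - (ulsubmx Z 0 0)^-1 *: ((ursubmx Z)^T *m ursubmx Z))].
Proof.
move=> [/symmetricmxP ZT Z_gt0]; set a := ulsubmx Z 0 0; set b := ursubmx Z.
have qZ y x : qform Z (col_mx y%:M x) =
    y ^+ 2 * a + 2 * y * (b *m x) 0 0 + qform (drsubmx Z) x.
  rewrite qform_col_mx // /qform tr_scalar_mx -mulmxA !mul_scalar_mx.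
  rewrite mul_mx_scalar -scalemxAl !mxE -/b expr2.
  have -> : Z (lshift d ord0) (lshift d ord0) = a by rewrite /a !mxE.
  by ring.
have ET : (drsubmx Z)^T = drsubmx Z by rewrite trmx_drsub ZT.
have a0 : 0 < a.
  have : 0 < qform Z (col_mx 1%:M 0).
    apply: Z_gt0; rewrite col_mx_eq0 negb_and; apply/orP; left.
    by apply/eqP => /matrixP/(_ 0 0)/eqP; rewrite !mxE oner_eq0.
  by rewrite qZ /qform !mulmx0 mxE expr1n mul1r mulr0 !addr0.
have cx0 (y : R) (x : 'cV[R]_d) : x != 0 -> 0 < qform Z (col_mx y%:M x).
  by move=> x0; rewrite Z_gt0 // col_mx_eq0 negb_and x0 orbT.
split=> //; split.
- exact/symmetricmxP.
- by move=> x /(cx0 0); rewrite qZ expr0n !(mul0r, mulr0) !add0r.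
- by apply/symmetricmxP; rewrite linearB linearZ /= trmx_mul trmxK ET.
move=> x /(cx0 (- (a^-1 * (b *m x) 0 0))); rewrite qZ.
suff -> : qform (drsubmx Z - a^-1 *: (b^T *m b)) x =
    qform (drsubmx Z) x - a^-1 * (b *m x) 0 0 ^+ 2.
  by congr (_ < _); field; rewrite gt_eqF.
rewrite /qform mulmxBr mulmxBl mxE; congr (_ + _).
rewrite -scalemxAr -scalemxAl mxE mxE; congr (- (_ * _)).
rewrite -!mulmxA mulmxA -trmx_mul.
by rewrite mxE big_ord1 !mxE expr2.
Qed.

(** Both determinants on the right have the shape of the left one in a smaller size, with a positive
    definite second summand. This is the recursion behind [det_diag_hoelder]. *)
Lemma det_diag_pivot (R : realType) (d : nat) (w : 'rV[R]_(1 + d)) (Z : 'M[R]_(1 + d)) :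
  posdefmx Z ->
  \det (diag_mx w + Z) =
    lsubmx w 0 0 * \det (diag_mx (rsubmx w) + drsubmx Z) +
    ulsubmx Z 0 0 * \det (diag_mx (rsubmx w) + (drsubmx Z -
      (ulsubmx Z 0 0)^-1 *: ((ursubmx Z)^T *m ursubmx Z))).
Proof.
move=> pZ; have [a0 _ _] := posdefmx_schur pZ.
rewrite -{1}[Z]submxK -{1}[w]hsubmxK diag_mx_row add_block_mx !add0r.
have -> : diag_mx (lsubmx w) + ulsubmx Z = (lsubmx w 0 0 + ulsubmx Z 0 0)%:M.
  by apply/matrixP => i j; rewrite !ord1 !mxE eqxx.
rewrite det_block_pivot ?gt_eqF // addrA.
by rewrite trmx_ursub (posdefmx_sym pZ).
Qed.

(** By [det_diag_pivot] each determinant is a sum of two positive terms. The induction hypothesis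
    bounds the two terms on the left, and Hoelder's inequality for two summands recombines the
    bounds. *)
Lemma det_diag_hoelder (R : realType) (d : nat) (w : 'rV[R]_d) (Z : 'M[R]_d) (t : R) :
  (forall i, 0 < w ord0 i) -> posdefmx Z -> 0 <= t <= 1 ->
  \det (diag_mx (rowpow w t) + Z) <=
    \det (1%:M + Z) `^ (1 - t) * \det (diag_mx w + Z) `^ t.
Proof.
move=> w0 pZ t01; elim: d w Z w0 pZ => [|d IH] w Z w0 pZ.
  by rewrite !det_mx00 !powR1 mul1r.
rewrite -diag_const_mx !det_diag_pivot // -/(1 + d)%N.
have [] := posdefmx_schur (pZ : posdefmx (Z : 'M[R]_(1 + d))).
set a := ulsubmx _ 0 0; set Z' := drsubmx _; set S := Z' - _ => a0 pZ' pS.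
have -> : rsubmx (rowpow w t : 'rV_(1 + d)) = rowpow (rsubmx (w : 'rV_(1 + d))) t.
  by apply/rowP => i; rewrite !mxE.
set u := rsubmx (w : 'rV_(1 + d)).
have u0 i : 0 < u ord0 i by rewrite mxE.
have -> : rsubmx (const_mx 1 : 'rV[R]_(1 + d)) = const_mx 1.
  by apply/rowP => i; rewrite !mxE.
have -> : lsubmx (const_mx 1 : 'rV[R]_(1 + d)) 0 0 = 1 by rewrite !mxE.
rewrite diag_const_mx mul1r; set w1 := lsubmx (w : 'rV_(1 + d)) 0 0.
have w1_gt0 : 0 < w1 by rewrite /w1 mxE.
have -> : lsubmx (rowpow w t : 'rV_(1 + d)) 0 0 = w1 `^ t by rewrite /w1 !mxE.
have d1 A : posdefmx A -> 0 < \det (1%:M + A : 'M[R]_d).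
  by move=> pA; apply/posdefmx_det_gt0/posdefmxD => //; exact: posdefmx1.
have du A : posdefmx A -> 0 < \det (diag_mx u + A).
  by move=> pA; apply/posdefmx_det_gt0/posdefmxD => //; exact: posdefmx_diag.
(* The booleans index the two terms of the pivot expansion. *)
have := @powR_hoelder_sum R bool
  (fun b => if b then \det (1%:M + Z') else a * \det (1%:M + S))
  (fun b => if b then w1 * \det (diag_mx u + Z') else a * \det (diag_mx u + S)) t.
rewrite !big_bool => hoelder.
apply: le_trans (hoelder _ _ t01); last 2 first.
- by case; rewrite ?mulr_ge0 // ltW // ?d1.
- by case; rewrite mulr_ge0 // ltW // ?du.
have powM x y s : 0 < x -> 0 < y -> (x * y) `^ s = x `^ s * y `^ s :> R.
  by move=> /ltW ? /ltW ?; exact: powRM.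
apply: lerD.
  rewrite powM ?du // mulrCA ler_pM2l ?powR_gt0 //; exact: IH.
have aE : a = a `^ (1 - t) * a `^ t.
  rewrite -powRD ?subrK ?powRr1 ?ltW //.
  by apply/implyP => _; rewrite gt_eqF.
rewrite !powM ?du ?d1 // mulrACA -aE ler_pM2l //; exact: IH.
Qed.

Lemma ln_le_hoelder (R : realType) (x a b t : R) :
  0 < x -> 0 < a -> 0 < b -> x <= a `^ (1 - t) * b `^ t ->
  ln x <= (1 - t) * ln a + t * ln b.
Proof.
move=> x0 a0 b0 xab; rewrite -!ln_powR -lnM ?posrE ?powR_gt0 //.
by rewrite ler_ln // posrE // mulr_gt0 ?powR_gt0.
Qed.

Lemma rowpow_gt0 (R : realType) (d : nat) (w : 'rV[R]_d) t :
  (forall i, 0 < w ord0 i) -> forall i, 0 < rowpow w t ord0 i.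
Proof. by move=> w0 i; rewrite mxE powR_gt0. Qed.

Lemma rowpow_le (R : realType) (d : nat) (w : 'rV[R]_d) t i :
  (forall i, 0 < w ord0 i) -> 0 <= t <= 1 ->
  rowpow w t ord0 i <= (1 - t) + t * w ord0 i.
Proof.
move=> w0 t01; have := powR_amgm ler01 (ltW (w0 i)) t01.
by rewrite powR1 mul1r mulr1 mxE.
Qed.

(** Writing [Y = N Z N^T] takes the factor [n = (\det N)^2] out of all three determinants. It
    cancels because [n^(1 - t) n^t = n]. *)
Lemma det_congr_diag_hoelder (R : realType) (d : nat) (N Y : 'M[R]_d) (w : 'rV[R]_d) (t : R) :
  N \in unitmx -> (forall i, 0 < w ord0 i) -> posdefmx Y -> 0 <= t <= 1 ->
  \det (N *m diag_mx (rowpow w t) *m N^T + Y) <=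
    \det (N *m N^T + Y) `^ (1 - t) * \det (N *m diag_mx w *m N^T + Y) `^ t.
Proof.
move=> uN w0 pY t01; pose Z := invmx N *m Y *m (invmx N)^T.
have pZ : posdefmx Z by apply: posdefmx_congr => //; rewrite unitmx_inv.
have YE : Y = N *m Z *m N^T.
  by rewrite /Z trmx_inv !mulmxA mulmxV // mul1mx mulmxKV // unitmx_tr.
have dE D : \det (N *m D *m N^T + Y) = \det N ^+ 2 * \det (D + Z).
  by rewrite {1}YE -mulmxDl -mulmxDr !det_mulmx det_tr expr2; ring.
have -> : N *m N^T = N *m 1%:M *m N^T by rewrite mulmx1.
have n0 : 0 < \det N ^+ 2.
  by rewrite exprn_even_gt0 //= -unitfE -unitmxE.
have d1 : 0 < \det (1%:M + Z).
  by apply/posdefmx_det_gt0/posdefmxD => //; exact: posdefmx1.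
have dw : 0 < \det (diag_mx w + Z).
  by apply/posdefmx_det_gt0/posdefmxD => //; exact: posdefmx_diag.
have powM x y s : 0 < x -> 0 < y -> (x * y) `^ s = x `^ s * y `^ s :> R.
  by move=> /ltW ? /ltW ?; exact: powRM.
rewrite !dE; move: (\det N ^+ 2) n0 => n n0.
rewrite !powM // mulrACA -powRD; last by apply/implyP => _; rewrite gt_eqF.
by rewrite subrK powRr1 ?ler_pM2l ?(ltW n0) //; exact: det_diag_hoelder.
Qed.

Lemma ln_det_congr_diag (R : realType) (d : nat) (N : 'M[R]_d) (w : 'rV[R]_d) (t : R) :
  N \in unitmx -> (forall i, 0 < w ord0 i) ->
  ln (\det (N *m diag_mx (rowpow w t) *m N^T)) =
    (1 - t) * ln (\det (N *m N^T)) + t * ln (\det (N *m diag_mx w *m N^T)).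
Proof.
move=> uN w0; rewrite !det_mulmx det_tr !det_diag.
have -> : \prod_i rowpow w t ord0 i = (\prod_i w ord0 i) `^ t.
  (* Nonnegativity is carried along because multiplicativity of real powers requires it. *)
  pose K (x y : R) := 0 <= y /\ x = y `^ t.
  suff [] : K (\prod_i rowpow w t ord0 i) (\prod_i w ord0 i) by [].
  apply: (big_ind2 K) => [|x y x' y' [y0 ->] [y0' ->]|i _].
  - by split; rewrite ?powR1.
  - by split; rewrite ?mulr_ge0 ?powRM.
  - by split; rewrite ?mxE ?ltW.
have p0 : 0 < \prod_i w ord0 i by exact: prodr_gt0.
have n0 : 0 < \det N ^+ 2.
  by rewrite exprn_even_gt0 //= -unitfE -unitmxE.
have dN x : \det N * x * \det N = \det N ^+ 2 * x by ring.
rewrite !dN -expr2; move: (\det N ^+ 2) n0 => n n0.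
rewrite !lnM ?posrE ?powR_gt0 // ln_powR; ring.
Qed.

(** In the coordinates [N^T x] the form is a sum of squares weighted by [w^t], so [rowpow_le]
    applies to each weight. *)
Lemma qform_congr_diag_le (R : realType) (d : nat) (N : 'M[R]_d) (w : 'rV[R]_d) (t : R) x :
  (forall i, 0 < w ord0 i) -> 0 <= t <= 1 ->
  qform (N *m diag_mx (rowpow w t) *m N^T) x <=
    (1 - t) * qform (N *m N^T) x + t * qform (N *m diag_mx w *m N^T) x.
Proof.
move=> w0 t01.
have -> : N *m N^T = N *m diag_mx (const_mx 1) *m N^T.
  by rewrite diag_const_mx mulmx1.
rewrite !qform_congr !qform_diag !mulr_sumr -big_split ler_sum //= => i _.
rewrite [const_mx _ _ _]mxE mulr1 [t * (_ * _)]mulrCA [(1 - t) * _]mulrC -mulrDr.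
by rewrite ler_wpM2l ?sqr_ge0 // rowpow_le.
Qed.

(** * Convexity of the individual functions *)

(** By [geodesic_diagonal] every geodesic has this diagonal form. *)
Lemma geodesically_convexP (R : realType) (d : nat) (f : 'M[R]_d -> R) :
  (forall (N : 'M[R]_d) (w : 'rV[R]_d) (t : R),
    N \in unitmx -> (forall i, 0 < w ord0 i) -> 0 <= t <= 1 ->
    f (N *m diag_mx (rowpow w t) *m N^T) <=
      (1 - t) * f (N *m N^T) + t * f (N *m diag_mx w *m N^T)) ->
  geodesically_convex f.
Proof.
move=> fP A B pA pB t t01.
have [N [w [uN w0 -> -> ->]]] := geodesic_diagonal pA pB.
exact: fP.
Qed.

Lemma posdefmx_congr_diag (R : realType) (d : nat) (N : 'M[R]_d) (w : 'rV[R]_d) :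
  N \in unitmx -> (forall i, 0 < w ord0 i) -> posdefmx (N *m diag_mx w *m N^T).
Proof. by move=> uN w0; apply: posdefmx_congr => //; exact: posdefmx_diag. Qed.

Lemma ln_sum_qform_convex (R : realType) (d n : nat) (hs : 'I_n -> 'cV[R]_d) :
  (0 < n)%N -> (forall i, hs i != 0) ->
  geodesically_convex (fun X : 'M[R]_d => ln (\sum_(i < n) qform X (hs i))).
Proof.
move=> n0 hs0; apply: geodesically_convexP => N w t uN w0 t01.
have sum_gt0 X : posdefmx X -> 0 < \sum_i qform X (hs i).
  move=> [_ pX]; rewrite (bigD1 (Ordinal n0)) //= ltr_pwDl ?pX //.
  by apply: sumr_ge0 => i _; rewrite ltW ?pX.
apply: ln_le_hoelder.
- by apply/sum_gt0/posdefmx_congr_diag => //; exact: rowpow_gt0.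
- exact/sum_gt0/posdefmx_gram.
- exact/sum_gt0/posdefmx_congr_diag.
(* In the coordinates [N^T h_i] the sum becomes [\sum_k c_k w_k^t]. Hoelder's inequality is applied
   to the families [c_k] and [c_k w_k]. *)
pose c k := \sum_i (N^T *m hs i) k ord0 ^+ 2.
have c0 k : 0 <= c k by apply: sumr_ge0 => i _; exact: sqr_ge0.
have sumE v : \sum_i qform (N *m diag_mx v *m N^T) (hs i) = \sum_k c k * v ord0 k.
  rewrite (eq_bigr _ (fun i _ => qform_congr _ _ _)).
  rewrite (eq_bigr _ (fun i _ => qform_diag _ _)) exchange_big /=.
  by apply: eq_bigr => k _; rewrite mulr_suml.
have <- : \sum_k c k = \sum_i qform (N *m N^T) (hs i).
  rewrite -[X in X *m _]mulmx1 -diag_const_mx sumE.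
  by apply: eq_bigr => k _; rewrite mxE mulr1.
rewrite !sumE.
apply: le_trans (powR_hoelder_sum c0 _ t01); last first.
  by move=> k; rewrite mulr_ge0 // ltW.
apply: ler_sum => k _; rewrite powRM // ?(ltW (w0 k)) // mulrA -powRD ?subrK ?oner_eq0 //.
by rewrite powRr1 // mxE.
Qed.

Lemma ln_det_convex (R : realType) (d : nat) :
  geodesically_convex (fun X : 'M[R]_d => ln (\det X)).
Proof.
by apply: geodesically_convexP => N w t uN w0 t01; rewrite ln_det_congr_diag.
Qed.

Lemma qform_convex (R : realType) (d : nat) (h : 'cV[R]_d) :
  geodesically_convex (fun X : 'M[R]_d => qform X h).
Proof.
by apply: geodesically_convexP => N w t uN w0 t01; exact: qform_congr_diag_le.
Qed.

Lemma qform_delta (R : realType) (d : nat) (X : 'M[R]_d) i :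
  qform X (delta_mx i 0) = X i i.
Proof. by rewrite /qform trmx_delta -rowE -colE !mxE. Qed.

Lemma mxtrace_convex (R : realType) (d : nat) :
  geodesically_convex (fun X : 'M[R]_d => \tr X).
Proof.
move=> A B pA pB t t01; rewrite /mxtrace !mulr_sumr -big_split ler_sum //= => i _.
by have := qform_convex (delta_mx i 0) pA pB t01; rewrite !qform_delta.
Qed.

(** The term in [ln (\det X)] is affine along the geodesic, so its negative sign is harmless;
    convexity comes from [ln (\det (X + Y))]. *)
Lemma S_divergence_convex (R : realType) (d : nat) (Y : 'M[R]_d) :
  posdefmx Y -> geodesically_convex (fun X : 'M[R]_d => S_divergence X Y).
Proof.
move=> pY; apply: geodesically_convexP => N w t uN w0 t01.
have SE X : posdefmx X -> S_divergence X Y =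
    d%:R * ln 2^-1 + ln (\det (X + Y)) - 2^-1 * (ln (\det X) + ln (\det Y)).
  move=> pX; rewrite /S_divergence detZ det_mulmx.
  have dXY := posdefmx_det_gt0 (posdefmxD pX pY).
  rewrite !lnM ?posrE ?exprn_gt0 ?invr_gt0 // ?posdefmx_det_gt0 //.
  by rewrite lnXn ?invr_gt0 // mulr_natl.
have pG := posdefmx_congr_diag uN (rowpow_gt0 t w0).
have pB := posdefmx_congr_diag uN w0.
have pA := posdefmx_gram uN.
rewrite !SE // ln_det_congr_diag //.
have := det_congr_diag_hoelder uN w0 pY t01.
move=> /ln_le_hoelder; rewrite !posdefmx_det_gt0; last 3 first.
- exact: posdefmxD.
- exact: posdefmxD.
- exact: posdefmxD.
by move=> /(_ isT isT isT); lra.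
Qed.

Lemma frobenius_norm_delta (R : realType) (d : nat) (i : 'I_d) :
  frobenius_norm (delta_mx i 0 : 'cV[R]_d) = 1.
Proof.
rewrite /frobenius_norm (bigD1 i) //= big_ord1 mxE !eqxx expr1n big1 ?addr0 ?sqrtr1 //.
by move=> k kNi; rewrite big_ord1 mxE (negPf kNi) /= expr0n.
Qed.

(** Ensures that [sup] is a genuine upper bound. The entries of a unit vector have absolute value at
    most 1. *)
Lemma qform_sphere_has_ubound (R : realType) (d : nat) (X : 'M[R]_d) :
  has_ubound [set qform X y | y in [set y : 'cV[R]_d | frobenius_norm y = 1]].
Proof.
exists (\sum_i \sum_j `|X j i|) => _ [y /= y1 <-].
have y_le1 i : `|y i ord0| <= 1.
  rewrite -y1 -sqrtr_sqr ler_wsqrtr // (bigD1 i) //= big_ord1 lerDl.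
  by apply: sumr_ge0 => k _; apply: sumr_ge0 => l _; exact: sqr_ge0.
rewrite /qform mxE ler_sum // => i _; rewrite mxE mulr_suml ler_sum // => j _.
rewrite mxE (le_trans (ler_norm _)) // !normrM -mulrA mulrCA -[leRHS]mulr1.
by rewrite ler_pM // ?mulr_ge0 // mulr_ile1.
Qed.

Lemma sup_qform_convex (R : realType) (d : nat) :
  (0 < d)%N ->
  geodesically_convex (fun X : 'M[R]_d =>
    sup [set qform X y | y in [set y : 'cV[R]_d | frobenius_norm y = 1]]).
Proof.
move=> d0 A B pA pB t t01; have /andP[t0 t1] := t01.
apply: ge_sup => [|_ [y y1 <-]].
  (* The supremum is bounded through its elements only for a nonempty set; a basis vector lies on
     the sphere because [d] is positive. *)
  by eexists; exists (delta_mx (Ordinal d0) 0); rewrite //= frobenius_norm_delta.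
apply: le_trans (qform_convex y pA pB t01) _.
by apply: lerD; rewrite ler_wpM2l ?subr_ge0 // ub_le_sup //;
  [exact: qform_sphere_has_ubound|exists y|exact: qform_sphere_has_ubound|exists y].
Qed.

(** With [V = N^(-T)] the inverse of [N diag(w^t) N^T] is [V diag((1/w)^t) V^T]. Inversion thus
    preserves the diagonal form, and [qform_congr_diag_le] applies with [V] and [1/w]. *)
Lemma invmx_convex (R : realType) (d : nat) :
  loewner_geodesically_convex (fun X : 'M[R]_d => invmx X).
Proof.
have symV (A : 'M[R]_d) : posdefmx A -> (invmx A)^T = invmx A.
  by move=> pA; rewrite trmx_inv posdefmx_sym.
split=> [A pA|A B pA pB t t01]; first exact/symmetricmxP/symV.
have [N [w [uN w0 AE BE GE]]] := geodesic_diagonal pA pB.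
have pG : posdefmx (geodesic A B t).
  by rewrite GE; apply: posdefmx_congr_diag => //; exact: rowpow_gt0.
split=> [|x].
  by apply/symmetricmxP; rewrite linearB linearD !linearZ /= !symV.
pose V := (invmx N)^T; pose winv := map_mx (fun x => x^-1) w.
have winv0 i : 0 < winv ord0 i by rewrite mxE invr_gt0.
have invE (v : 'rV[R]_d) : (forall i, 0 < v ord0 i) ->
    invmx (N *m diag_mx v *m N^T) = V *m diag_mx (map_mx (fun x => x^-1) v) *m V^T.
  move=> v0; set M := (RHS).
  have NM : N *m diag_mx v *m N^T *m M = 1%:M.
    rewrite /M /V trmxK trmx_inv !mulmxA mulmxK ?unitmx_tr //.
    rewrite -[N *m _ *m _]mulmxA mulmx_diag.
    have -> : \row_j (v 0 j * map_mx (fun x => x^-1) v 0 j) = const_mx 1.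
      by apply/rowP => j; rewrite !mxE divff // gt_eqF.
    by rewrite diag_const_mx mulmx1 mulmxV.
  by have [uM _] := mulmx1_unit NM; rewrite -[RHS](mulKmx uM) NM mulmx1.
have := qform_congr_diag_le V x winv0 t01.
have -> : rowpow winv t = map_mx (fun x => x^-1) (rowpow w t).
  by apply/rowP => i; rewrite !mxE -powR_inv1 ?(ltW (w0 i)) // -powRrM mulN1r powRN.
rewrite -invE; last exact: rowpow_gt0.
rewrite -invE // -GE -BE.
have -> : V *m V^T = invmx A.
  have := invE (const_mx 1); rewrite diag_const_mx mulmx1 -AE => ->; last first.
    by move=> i; rewrite mxE.
  rewrite [X in diag_mx X](_ : _ = const_mx 1) ?diag_const_mx ?mulmx1 //.
  by apply/rowP => j; rewrite !mxE invr1.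
rewrite -subr_ge0 => qge0; rewrite /qform mulmxBr mulmxBl mulmxDr mulmxDl.
rewrite -!scalemxAr -!scalemxAl.
by move: qge0; rewrite /qform => /le_trans; apply; rewrite !mxE.
Qed.

(** * From softplus to squares *)

Lemma MVT_is_derive (R : realType) (f df : R -> R) (a b : R) :
  (forall x, a <= x <= b -> is_derive x 1 f (df x)) -> a <= b ->
  exists2 c, a <= c <= b & f b - f a = df c * (b - a).
Proof.
move=> dfx ab; have [||c] := @MVT_segment R f df a b ab.
- by move=> x; rewrite in_itv => /andP[/ltW ax /ltW xb]; apply: dfx; rewrite ax xb.
- apply: derivable_within_continuous => x; rewrite in_itv => xab.
  by have [] := dfx _ xab.
by rewrite in_itv; exists c.
Qed.

Lemma is_derive_bounded_increment (R : realType) (f df : R -> R) (a b M : R) :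
  (forall x, a <= x <= b -> is_derive x 1 f (df x)) ->
  (forall x, a <= x <= b -> `|df x| <= M) ->
  forall x y, a <= x <= b -> a <= y <= b -> `|f x - f y| <= M * `|x - y|.
Proof.
move=> dfx dfM; suff H x y : x <= y -> a <= x <= b -> a <= y <= b ->
    `|f x - f y| <= M * `|x - y|.
  move=> x y xab yab; have [xy|/ltW yx] := leP x y; first exact: H.
  by rewrite distrC [`|x - y|]distrC; exact: H.
move=> xy /andP[ax _] /andP[_ yb].
have xyab z : x <= z <= y -> a <= z <= b by lra.
rewrite distrC [`|x - y|]distrC.
have [c cxy ->] := MVT_is_derive (fun z zxy => dfx z (xyab z zxy)) xy.
by rewrite normrM ler_wpM2r // dfM // xyab.
Qed.

(** The integral from [a], by the fundamental theorem of calculus. A bounded interval suffices,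
    since the later argument works in a fixed window. *)
Lemma softplus_antiderivative (R : realType) (a b : R) : a < b ->
  exists K : R -> R, forall x, a < x < b -> is_derive x 1 K (ln (1 + expR x)).
Proof.
move=> ab; pose sp (x : R) := ln (1 + expR x).
have csp : continuous sp.
  move=> x; apply: (@continuous_comp _ _ _ (fun x => 1 + expR x) (@ln R)).
    by apply: continuousD; [exact: cst_continuous|exact: continuous_expR].
  by apply: continuous_ln; rewrite addr_gt0 ?expR_gt0.
exists (fun y => \int[lebesgue_measure]_(t in `[a, y]) sp t)%R => x /andP[ax xb].
have [|dK] := @continuous_FTC1_closed R sp a x b xb _ ax (csp x).
  apply: continuous_compact_integrable; first exact: segment_compact.
  exact: continuous_subspaceT.
by rewrite derive1E => KE; rewrite -[ln _]/(sp x) -KE; exact: derivableP.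
Qed.

Lemma is_derive_sumfun (R : realType) (J : finType) (F : J -> R -> R) (dF : J -> R) (x : R) :
  (forall j, is_derive x 1 (F j) (dF j)) ->
  is_derive x 1 (fun r => \sum_j F j r) (\sum_j dF j).
Proof.
move=> FdF; have -> : (fun r => \sum_j F j r) = \sum_j F j.
  by apply/funext => r; rewrite fct_sumE.
by elim/big_ind2 : _ => // [|] *; [exact: is_derive_cst|exact: is_deriveD].
Qed.

Lemma ln1Dexp_le (R : realType) (x : R) : 0 <= ln (1 + expR x) <= expR x.
Proof.
apply/andP; split; first by rewrite ln_ge0 // lerDl ltW ?expR_gt0.
by rewrite -[leRHS]expRK ler_ln ?posrE ?addr_gt0 ?expR_gt0 // expR_ge1Dx.
Qed.

(** Reduces the behaviour at plus infinity to that at minus infinity, which [ln1Dexp_le]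
    controls. *)
Lemma ln1Dexp_reflect (R : realType) (x : R) : ln (1 + expR x) - x = ln (1 + expR (- x)).
Proof.
have e0 := expR_gt0 x.
have -> : 1 + expR x = expR x * (1 + expR (- x)).
  by rewrite mulrDr mulr1 expRN divff ?gt_eqF // addrC.
by rewrite lnM ?posrE ?expR_gt0 ?addr_gt0 ?expR_gt0 // expRK addrC addKr.
Qed.

Lemma ln_expRD (R : realType) (u r : R) :
  ln (expR u + expR r) = u + ln (1 + expR (r - u)).
Proof.
have -> : expR u + expR r = expR u * (1 + expR (r - u)).
  by rewrite mulrDr mulr1 -expRD [u + (r - u)]addrC subrK.
by rewrite lnM ?posrE ?expR_gt0 ?addr_gt0 ?expR_gt0 // expRK.
Qed.

(* With K' = log (1 + e^s), the assumption integrates over r in [-L, L] to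
   0 <= sum_j m_j (K (L - z_j) - K (- L - z_j)); since K (x) - x^2 / 2 at +oo and
   K at -oo are asymptotically constant, the right-hand side tends to
   sum_j m_j z_j^2 / 2. *)
Lemma sum_sqr_ge0_of_softplus (R : realType) (J : finType) (m z : J -> R) :
  \sum_j m j = 0 -> \sum_j m j * z j = 0 ->
  (forall r, 0 <= \sum_j m j * ln (expR (z j) + expR r)) ->
  0 <= \sum_j m j * z j ^+ 2.
Proof.
move=> m0 mz0 mln; pose U := \sum_j `|z j|; pose W := \sum_j `|m j|.
have U0 : 0 <= U by exact: sumr_ge0.
have W0 : 0 <= W by exact: sumr_ge0.
have zU j : `|z j| <= U by rewrite /U (bigD1 j) //= lerDl sumr_ge0.
(* A window of half-width [U + s] gives the claim up to an error that decays exponentially in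
   [s]. *)
suff main s : 0 < s -> - (4 * W * U * expR (- s)) <= \sum_j m j * z j ^+ 2.
  set S := \sum_j _ in main *; rewrite leNgt; apply/negP => S0.
  set C := 4 * W * U in main; have C0 : 0 <= C by rewrite !mulr_ge0.
  (* If [S < 0], then [1 + s <= expR s] makes [C * expR (- s)] smaller than [- S] for this [s],
     which contradicts [main]. *)
  pose s := C / - S + 1; have s0 : 0 < s by rewrite ltr_wpDl ?divr_ge0 ?oppr_ge0 ?(ltW S0).
  have := main s s0; apply/negP; rewrite -ltNge ltrNr expRN.
  rewrite ltr_pdivrMr ?expR_gt0 //.
  apply: (@lt_le_trans _ _ (- S * (1 + s))); last first.
    by rewrite ler_wpM2l ?expR_ge1Dx // oppr_ge0 ltW.
  rewrite /s mulrDr mulr1 mulrDr mulrCA divff ?mulr1 ?oppr_eq0 ?lt_eqF //; lra.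
move=> s0; pose L := U + s.
(* All arguments [r - z_j] with [|r| <= L] lie in [[- (L + U), L + U]]; the margin 1 makes the ends
   of this segment interior points. *)
have [|K dK] := @softplus_antiderivative R (- (L + U) - 1) (L + U + 1).
  by rewrite /L; lra.
have zU' j : - U <= z j <= U by rewrite -ler_norml.
have K_le j : `|K (- L - z j) - K (- L)| <= expR (- s) * U.
  apply: (@le_trans _ _ (expR (- s) * `|- L - z j - - L|)).
    apply: (@is_derive_bounded_increment R K (fun x => ln (1 + expR x)) (- (L + U)) (- s)).
    - by move=> x xI; apply: dK; rewrite /L in xI *; lra.
    - move=> x /andP[_ xs]; have /andP[l0 l1] := ln1Dexp_le x.
      by rewrite ger0_norm // (le_trans l1) // ler_expR.
    - by have := zU' j; rewrite /L; lra.
    - by rewrite /L; lra.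
  by rewrite ler_wpM2l ?expR_ge0 // opprK addrAC addNr add0r normrN.
(* The derivative of [k] is [ln (1 + expR (- x))], at most [expR (- s)] for [x >= s], and
   [L - z_j >= s]. *)
pose k x := K x - x ^+ 2 / 2.
have k_le j : `|k (L - z j) - k L| <= expR (- s) * U.
  apply: (@le_trans _ _ (expR (- s) * `|L - z j - L|)).
    apply: (@is_derive_bounded_increment R k (fun x => ln (1 + expR x) - x) s (L + U)).
    - move=> x xI; have dKx : is_derive x 1 K (ln (1 + expR x)).
        by apply: dK; rewrite /L in xI *; lra.
      have -> : k = K - 2^-1 \*: (@id R ^+ 2).
        by apply/funext => y; congr (_ - _); exact: mulrC.
      by apply: is_derive_eq; rewrite /GRing.scale /= mulr1; field.
    - move=> x /andP[sx _]; rewrite ln1Dexp_reflect; have /andP[l0 l1] := ln1Dexp_le (- x).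
      by rewrite ger0_norm // (le_trans l1) // ler_expR lerN2.
    - by have := zU' j; rewrite /L; lra.
    - by rewrite /L; lra.
  by rewrite ler_wpM2l ?expR_ge0 // addrAC subrr add0r normrN.
(* Its derivative is the sum in the hypothesis minus [\sum_j m_j z_j], which is 0; so it is
   nonnegative. *)
pose G r := \sum_j m j * K (r - z j).
have G_le : G (- L) <= G L.
  have [||c _] := @MVT_is_derive R G (fun r => \sum_j m j * ln (1 + expR (r - z j))) (- L) L.
  - move=> x xL; apply: is_derive_sumfun => j.
    have dKx : is_derive (x - z j) 1 K (ln (1 + expR (x - z j))).
      by apply: dK; have := zU' j; rewrite /L in xL *; lra.
    have -> : (fun r => m j * K (r - z j)) = m j \*: (K \o (id - cst (z j))) by [].
    by apply: is_derive_eq; rewrite /GRing.scale /= subr0 mulr1.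
  - by rewrite /L; lra.
  rewrite -subr_ge0 => ->; rewrite mulr_ge0 //; last by rewrite /L; lra.
  have -> : \sum_j m j * ln (1 + expR (c - z j)) =
     \sum_j m j * ln (expR (z j) + expR c) - \sum_j m j * z j.
    rewrite -sumrB; apply: eq_bigr => j _; rewrite ln_expRD; ring.
  by rewrite mz0 subr0.
pose E j := (k (L - z j) - k L) - (K (- L - z j) - K (- L)).
have E_le : \sum_j m j * E j <= 2 * W * U * expR (- s).
  have -> : 2 * W * U * expR (- s) = \sum_j `|m j| * (2 * (expR (- s) * U)).
    by rewrite -mulr_suml -/W; ring.
  apply: ler_sum => j _.
  apply: le_trans (ler_norm _) _; rewrite normrM.
  rewrite ler_wpM2l //; apply: le_trans (ler_normB _ _) _.
  by have := k_le j; have := K_le j; lra.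
(* In [(L - z_j)^2 / 2] the parts constant and linear in [z_j] vanish by [m0] and [mz0]. *)
have GE : G L - G (- L) = (\sum_j m j * z j ^+ 2) / 2 + \sum_j m j * E j.
  rewrite /G -sumrB.
  transitivity (\sum_j (m j * z j ^+ 2 / 2 + m j * E j + (m j * z j * (- L))
     + m j * (L ^+ 2 / 2 + k L - K (- L)))).
    by apply: eq_bigr => j _; rewrite /E /k; field.
  by rewrite !big_split /= -!mulr_suml m0 mz0 !mul0r !addr0.
by move: G_le; rewrite -subr_ge0 GE; lra.
Qed.

(** * The squared Riemannian distance *)

Lemma ln_prod (R : realType) (I : finType) (x : I -> R) :
  (forall i, 0 < x i) -> ln (\prod_i x i) = \sum_i ln (x i).
Proof.
move=> x0; pose K (p s : R) := 0 < p /\ ln p = s.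
suff [] : K (\prod_i x i) (\sum_i ln (x i)) by [].
apply: (big_ind2 K) => [|p s p' s' [p0 <-] [p'0 <-]|i _] //.
- by split; rewrite ?ln1.
- by split; rewrite ?mulr_gt0 ?lnM.
Qed.

Lemma sqr_frobenius_norm (R : realType) (m n : nat) (M : 'M[R]_(m, n)) :
  frobenius_norm M ^+ 2 = \tr (M *m M^T).
Proof.
rewrite sqr_sqrtr; last by apply: sumr_ge0 => i _; apply: sumr_ge0 => j _; exact: sqr_ge0.
apply: eq_bigr => i _; rewrite mxE; apply: eq_bigr => j _; by rewrite mxE expr2.
Qed.

(** Here [u] lists the logarithms of the eigenvalues. The three equations supply the conclusion, the
    first moment and the hypothesis in [sum_sqr_ge0_of_softplus]. *)
Lemma posdefmx_log_spectrum (R : realType) (d : nat) (X : 'M[R]_d) :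
  posdefmx X ->
  exists u : 'I_d -> R,
    [/\ frobenius_norm (mxlog X) ^+ 2 = \sum_i u i ^+ 2,
        ln (\det X) = \sum_i u i &
        forall r, ln (\det (X + (expR r)%:M)) = \sum_i ln (expR (u i) + expR r)].
Proof.
move=> /posdefmx_spectral[Q [v [QQT v0 ->]]]; exists (fun i => ln (v ord0 i)).
have QTQ := mulmx1C QQT; split=> [||r].
- rewrite /mxlog mxfunE // sqr_frobenius_norm !trmx_mul trmxK tr_diag_mx.
  rewrite mxtrace_mulC !mulmxA -[_ *m Q^T *m Q]mulmxA QTQ mulmx1.
  rewrite mxtrace_mulC !mulmxA QTQ mul1mx mulmx_diag mxtrace_diag.
  by apply: eq_bigr => i _; rewrite !mxE expr2.
- by rewrite det_conj_orthogonal // det_diag ln_prod.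
have -> : (expR r)%:M = Q *m (expR r)%:M *m Q^T.
  by rewrite mul_mx_scalar -scalemxAl QQT scalemx1.
rewrite -mulmxDl -mulmxDr det_conj_orthogonal //.
rewrite -diag_const_mx -linearD det_diag ln_prod => [|i].
  by apply: eq_bigr => i _; rewrite !mxE lnK ?posrE.
by rewrite !mxE addr_gt0 ?expR_gt0.
Qed.

Lemma sqr_norm_log_convex (R : realType) (d : nat) (Y : 'M[R]_d) :
  posdefmx Y ->
  geodesically_convex (fun X : 'M[R]_d =>
    frobenius_norm (mxlog (mxpow Y (- 2^-1) *m X *m mxpow Y (- 2^-1))) ^+ 2).
Proof.
move=> pY; have := posdefmx_mxpow (- 2^-1) pY; set P := mxpow _ _ => pP.
apply: geodesically_convexP => N w t uN w0 t01; pose M := P *m N.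
have uM : M \in unitmx by rewrite unitmx_mul posdefmx_unit.
have conjE D : P *m (N *m D *m N^T) *m P = M *m D *m M^T.
  by rewrite /M trmx_mul (posdefmx_sym pP) !mulmxA.
have -> : P *m (N *m N^T) *m P = M *m M^T.
  by rewrite /M trmx_mul (posdefmx_sym pP) !mulmxA.
rewrite !conjE.
have pG := posdefmx_congr_diag uM (rowpow_gt0 t w0).
have pB := posdefmx_congr_diag uM w0.
have pA := posdefmx_gram uM.
have [a [-> detA lnA]] := posdefmx_log_spectrum pA.
have [b [-> detB lnB]] := posdefmx_log_spectrum pB.
have [g [-> detG lnG]] := posdefmx_log_spectrum pG.
(* Signed weights that encode the convexity defect: [1 - t] and [t] on the spectra at the endpoints,
   -1 on the spectrum at the geodesic point. The total mass is 0, and the first moment vanishes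
   because [ln \det] is affine. *)
pose m (j : 'I_d + 'I_d + 'I_d) : R :=
  match j with inl (inl _) => 1 - t | inl (inr _) => t | inr _ => -1 end.
pose z (j : 'I_d + 'I_d + 'I_d) : R :=
  match j with inl (inl i) => a i | inl (inr i) => b i | inr i => g i end.
have mF (F : R -> R) : \sum_j m j * F (z j) =
    (1 - t) * \sum_i F (a i) + t * \sum_i F (b i) - \sum_i F (g i).
  rewrite !big_sumType /= !mulr_sumr -sumrN; congr (_ + _).
  by apply: eq_bigr => i _; rewrite mulN1r.
suff : 0 <= \sum_j m j * z j ^+ 2 by rewrite (mF (fun x => x ^+ 2)) subr_ge0.
apply: sum_sqr_ge0_of_softplus.
- have := mF (fun=> 1); rewrite (eq_bigr _ (fun j _ => mulr1 (m j))) => ->; ring.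
- by rewrite (mF id) -detA -detB -detG ln_det_congr_diag // subrr.
move=> r; rewrite (mF (fun x => ln (expR x + expR r))) -lnA -lnB -lnG subr_ge0.
have pr : posdefmx ((expR r)%:M : 'M[R]_d).
  by rewrite -scalemx1; apply: posdefmxZ; [exact: expR_gt0|exact: posdefmx1].
apply: ln_le_hoelder; last exact: det_congr_diag_hoelder.
- exact/posdefmx_det_gt0/posdefmxD.
- exact/posdefmx_det_gt0/posdefmxD.
- exact/posdefmx_det_gt0/posdefmxD.
Qed.

Theorem proposition33 (R : realType) (d : nat) (h : 'cV[R]_d)
    (n : nat) (n_ge1 : (1 <= n)%N)
    (hs : 'I_n -> 'cV[R]_d) (hs_neq0 : forall i, hs i != 0) :
  geodesically_convex (fun X : 'M[R]_d => ln (\sum_(i < n) qform X (hs i))) /\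
  geodesically_convex (fun X : 'M[R]_d => ln (\det X)) /\
  geodesically_convex (fun X : 'M[R]_d => qform X h) /\
  geodesically_convex (fun X : 'M[R]_d => \tr X) /\
  (forall Y : 'M[R]_d, posdefmx Y ->
    geodesically_convex (fun X : 'M[R]_d => S_divergence X Y)) /\
  (forall Y : 'M[R]_d, posdefmx Y ->
    geodesically_convex (fun X : 'M[R]_d =>
      frobenius_norm
        (mxlog (mxpow Y (- 2^-1) *m X *m mxpow Y (- 2^-1))) ^+ 2)) /\
  geodesically_convex (fun X : 'M[R]_d =>
    sup [set qform X y | y in [set y : 'cV[R]_d | frobenius_norm y = 1]]) /\
  loewner_geodesically_convex (fun X : 'M[R]_d => invmx X).
Proof.
(* A nonzero vector has a nonzero coordinate, hence an index below [d]. *)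
have d_gt0 : (0 < d)%N.
  have /matrix0Pn[i _] := hs_neq0 (Ordinal n_ge1).
  exact: leq_ltn_trans (ltn_ord i).
split; first exact: ln_sum_qform_convex.
split; first exact: ln_det_convex.
split; first exact: qform_convex.
split; first exact: mxtrace_convex.
split; first exact: S_divergence_convex.
split; first exact: sqr_norm_log_convex.
by split; [exact: sup_qform_convex|exact: invmx_convex].
Qed.
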